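(* For $r\in\{3,4\}$ the family $\Sigma_r$ is degree-stable with respect to $\mathfrak K^r_r$.
   Context: An $r$-graph is a finite $r$-uniform hypergraph $\mathcal H$, identified with its edge set; $\delta(\mathcal H)$ is its minimum vertex degree (the degree of a vertex is the number of edges containing it). For a family $\mathcal F$ of $r$-graphs, $\mathcal H$ is $\mathcal F$-free if it contains no member of $\mathcal F$ as a (not necessarily induced) subgraph; $\mathrm{ex}(n,\mathcal F)$ is the maximum number of edges of an $\mathcal F$-free $r$-graph on $n$ vertices, and $\pi(\mathcal F)=\lim_{n\to\infty}\mathrm{ex}(n,\mathcal F)/\binom nr$. $\Sigma_r$ is the collection of all $r$-graphs with three edges $A,B,C$ such that $|B\cap C|=r-1$ and $B\triangle C\subseteq A$ (with vertex set $A\cup B\cup C$). An $r$-graph $\mathcal H$ is a blowup of an $r$-graph $F$ if there is a map $\psi\colon V(\mathcal H)\to V(F)$ (not necessarily surjective) such that for every $r$-subset $E$ of $V(\mathcal H)$ one has $E\in\mathcal H$ if and only if $\psi(E)\in F$. $K^r_\ell$ is the complete $r$-graph on $\ell$ vertices and $\mathfrak K^r_\ell$ is the class of all blowups of $K^r_\ell$; thus $\mathfrak K^r_r$ is the class of complete $r$-partite $r$-graphs (parts may be empty). A family $\mathcal F$ is degree-stable with respect to a class $\mathfrak H$ of $\mathcal F$-free $r$-graphs if there exist $\epsilon>0$ and $N_0$ such that every $\mathcal F$-free $r$-graph $\mathcal H$ on $n\ge N_0$ vertices with $\delta(\mathcal H)\ge(\pi(\mathcal F)/(r-1)!-\epsilon)n^{r-1}$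 is a subgraph of some member of $\mathfrak H$. *)

(* Defs.v *)
From HB Require Import structures.
From mathcomp Require Import all_boot all_order all_algebra.
From mathcomp Require Import all_classical all_reals all_analysis.
Import Order.TTheory GRing.Theory Num.Theory.
Import numFieldNormedType.Exports.

Set Implicit Arguments.
Unset Strict Implicit.
Unset Printing Implicit Defensive.

Local Open Scope nat_scope.
Local Open Scope set_scope.

Record rgraph (r : nat) (V : finType) := RGraph {
  edges : {set {set V}};
  edges_uniform : [forall e in edges, #|e| == r] }.

HB.instance Definition _ r V := [isSub for @edges r V].
HB.instance Definition _ r V := [Finite of rgraph r V by <:].

(* A family or class of r-graphs, on arbitrary finite vertex types. *)
Definition rclass (r : nat) := forall V : finType, rgraph r V -> Prop.

Definition degree (r : nat) (V : finType) (H : rgraph r V) (v : V) : nat :=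
  #|[set e in edges H | v \in e]|.

(* Degrees never exceed the number of edges, so the default value of the
   iterated minimum only matters when there are no vertices. *)
Definition min_degree (r : nat) (V : finType) (H : rgraph r V) : nat :=
  \big[minn/#|edges H|]_(v : V) degree H v.

(* Up to isomorphism: F embeds in H, not necessarily as an induced or
   spanning subgraph. *)
Definition subgraph (r : nat) (V W : finType)
    (F : rgraph r V) (H : rgraph r W) : Prop :=
  exists2 f : V -> W, injective f &
    forall e : {set V}, e \in edges F -> f @: e \in edges H.

Definition family_free (r : nat) (F : rclass r) (W : finType) (H : rgraph r W) : Prop :=
  forall (V : finType) (G : rgraph r V), F V G -> ~ subgraph G H.

Definition ex_number (n r : nat) (F : rclass r) : nat :=
  \max_(H : rgraph r 'I_n | `[< family_free F H >]) #|edges H|.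

Definition turan_density (R : realType) (r : nat) (F : rclass r) : R :=
  limn (fun n : nat => ((ex_number n F)%:R / 'C(n, r)%:R)%R : R).

Definition Sigma (r : nat) : rclass r := fun V H =>
  exists A B C : {set V},
    [/\ edges H = [set A; B; C], #|edges H| = 3, #|B :&: C| = r.-1,
        (B :\: C) :|: (C :\: B) \subset A & A :|: B :|: C = [set: V]].

Arguments Sigma r V H : clear implicits.

(* If psi is not injective on E, then psi @: E has fewer than r elements and
   so is not an edge of F. *)
Definition is_blowup (r : nat) (V W : finType)
    (H : rgraph r V) (F : rgraph r W) : Prop :=
  exists psi : V -> W, forall E : {set V}, #|E| = r ->
    (E \in edges H <-> psi @: E \in edges F).

Lemma complete_rgraph_subproof (r l : nat) :
  [forall e in [set e : {set 'I_l} | #|e| == r], #|e| == r].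
Proof. by apply/forall_inP => e; rewrite inE. Qed.

Definition complete_rgraph (r l : nat) : rgraph r 'I_l :=
  RGraph (complete_rgraph_subproof r l).

Definition blowups_of_complete (r l : nat) : rclass r :=
  fun V H => is_blowup H (complete_rgraph r l).

Arguments blowups_of_complete r l V H : clear implicits.

Definition degree_stable (R : realType) (r : nat) (F K : rclass r) : Prop :=
  (forall (V : finType) (H : rgraph r V), K V H -> family_free F H) /\
  exists (eps : R) (N0 : nat), (0 < eps)%R /\
    forall (V : finType) (H : rgraph r V),
      N0 <= #|V| -> family_free F H ->
      ((turan_density R F / (r.-1)`!%:R - eps) * #|V|%:R ^+ r.-1
         <= (min_degree H)%:R)%R ->
      exists (W : finType) (G : rgraph r W), K W G /\ subgraph H G.

(* Main.v *)
Require Import Defs.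
From mathcomp Require Import all_boot all_order all_algebra.
From mathcomp Require Import zify ring lra.
(* Imported again because fingraph also defines an [rgraph]. *)
Require Import Defs.

(* Join two vertices of H when some edge contains both, and let the link of x
   consist of the (r-1)-sets S with x + S an edge. Then H is Sigma_r-free exactly
   when adjacent vertices have disjoint links. Hence over a clique the links
   partition a subfamily of the (r-1)-cliques, and Zykov's bound on the number of
   (r-1)-cliques, with the minimum degree condition, limits the clique number to r;
   only the clique number 5 for r = 4 survives this. In that case the links are
   cancellative 3-graphs, so by Bollobas' theorem all degrees of the graph are
   about 3n/4 or more, and the triangle count forces an average degree of at least
   .78 n; thus the edges of H extend to 5-cliques more often than the number of
   5-cliques allows, as each of them contains at most one edge of H.
   Once the clique number is r, fix an edge Q of H. The links of the vertices of
   any r-clique cover almost all (r-1)-cliques, so the link of every vertex is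
   close to the link of one vertex of Q, which is its colour; adjacent vertices
   have disjoint links and therefore different colours. Of the Turan density only
   the bound pi >= r!/r^r is needed. *)

Set Implicit Arguments.
Unset Strict Implicit.
Unset Printing Implicit Defensive.

Import Order.TTheory GRing.Theory Num.Theory.

(** * Counting cliques *)

Lemma card_bigcup_le (I T : finType) (P : pred I) (F : I -> {set T}) :
  #|\bigcup_(i | P i) F i| <= \sum_(i | P i) #|F i|.
Proof.
elim/big_rec2: _ => [|i n U _ IH]; first by rewrite cards0.
by apply: leq_trans (leq_card_setU _ _) _; rewrite leq_add2l.
Qed.

Lemma sum_card_exchange (I T : finType) (P : pred I) (F : I -> {set T}) (U : {set T}) :
  (forall i, P i -> F i \subset U) ->
  \sum_(i | P i) #|F i| = \sum_(u in U) #|[set i | P i & u \in F i]|.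
Proof.
move=> FU; transitivity (\sum_(i | P i) \sum_(u in U) (u \in F i : nat)).
  apply: eq_bigr => i Pi; rewrite -sum1_card (big_setID (F i) (A := U)) /=.
  rewrite (setIidPr (FU i Pi)) [X in _ + X]big1 ?addn0; last first.
    by move=> u; rewrite inE => /andP[/negbTE-> _].
  by apply: eq_bigr => u ->.
rewrite exchange_big; apply: eq_bigr => u _; rewrite -sum1_card big_mkcond /=.
by rewrite [RHS]big_mkcond; apply: eq_bigr => i _; rewrite inE; case: (P i) (u \in F i) => -[].
Qed.

Lemma sum_card_disjoint (I T : finType) (P : pred I) (F : I -> {set T}) (U : {set T}) :
  (forall i, P i -> F i \subset U) ->
  (forall i j u, P i -> P j -> u \in F i -> u \in F j -> i = j) ->
  \sum_(i | P i) #|F i| <= #|U|.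
Proof.
move=> FU Fdisj; rewrite (sum_card_exchange FU) -sum1_card leq_sum // => u _.
apply/card_le1P => i; rewrite inE => /andP[Pi ui] j; rewrite inE.
by apply/andP/eqP => [[Pj uj]|->]; [exact: Fdisj uj ui | rewrite Pi].
Qed.

Section Cliques.
Variables (T : finType) (e : rel T).
Hypotheses (e_sym : symmetric e) (e_irr : irreflexive e).
Implicit Types (A K S : {set T}) (x y : T).

Definition clique K := [forall x in K, forall y in K, (x != y) ==> e x y].
Definition nbrs A x := [set y in A | e x y].
Definition cliques A t := [set K : {set T} | [&& K \subset A, #|K| == t & clique K]].

Lemma cliqueP K : reflect {in K &, forall x y, x != y -> e x y} (clique K).
Proof.
apply: (iffP forall_inP) => h x.
  by move=> y xK yK xy; have /forall_inP/(_ y yK)/implyP/(_ xy) := h x xK.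
by move=> xK; apply/forall_inP => y yK; apply/implyP => xy; apply: h.
Qed.

Lemma cliquesP A t K :
  reflect [/\ K \subset A, #|K| = t & clique K] (K \in cliques A t).
Proof. by rewrite inE; apply: (iffP and3P) => -[? /eqP]. Qed.

Lemma clique_sub K S : S \subset K -> clique K -> clique S.
Proof.
move=> /subsetP SK /cliqueP Kcl; apply/cliqueP => x y xS yS.
by apply: Kcl; apply: SK.
Qed.

Lemma cliqueU1 x K : clique K -> {in K, forall y, e x y} -> clique (x |: K).
Proof.
move=> /cliqueP Kcl xK; apply/cliqueP => y z /setU1P[->|yK] /setU1P[->|zK].
- by rewrite eqxx.
- by move=> _; apply: xK.
- by move=> _; rewrite e_sym; apply: xK.
- exact: Kcl.
Qed.

Lemma nbrsS A x : nbrs A x \subset A.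
Proof. by apply/subsetP => y; rewrite inE => /andP[]. Qed.

Lemma cliques0 A : cliques A 0 = [set set0].
Proof.
apply/setP => K; rewrite !inE cards_eq0; apply/and3P/eqP => [[_ /eqP]|->] //.
by rewrite sub0set eqxx; split=> //; apply/cliqueP => x y; rewrite inE.
Qed.

Lemma card_cliques1 A : #|cliques A 1| <= #|A|.
Proof.
rewrite -(card_imset (mem A) (@set1_inj T)); apply/subset_leq_card/subsetP => K.
case/cliquesP => KA /eqP/cards1P[x Kx] _; apply/imsetP; exists x => //.
by move: KA; rewrite Kx sub1set.
Qed.

Lemma cliques_le A s t : cliques A s = set0 -> s <= t -> cliques A t = set0.
Proof.
move=> As st; apply/setP => K; rewrite in_set0; apply/negbTE/negP.
case/cliquesP => KA Kt Kcl.
have [S /andP[SK /eqP Ss]] : exists S : {set T}, (S \subset K) && (#|S| == s).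
  have : 0 < #|[set S : {set T} | S \subset K & #|S| == s]|.
    by rewrite cards_draws bin_gt0 Kt.
  by case/card_gt0P => S; rewrite inE => ?; exists S.
have : S \in cliques A s.
  by apply/cliquesP; split=> //; [exact: subset_trans KA | exact: clique_sub Kcl].
by rewrite As inE.
Qed.

Lemma nbrs_clique_free A x s : x \in A ->
  cliques A s.+1 = set0 -> cliques (nbrs A x) s = set0.
Proof.
move=> xA As; apply/setP => K; rewrite in_set0; apply/negbTE/negP.
case/cliquesP => /subsetP KN Ks Kcl.
have xK : x \notin K.
  by apply/negP => /KN; rewrite inE e_irr andbF.
have : x |: K \in cliques A s.+1.
  apply/cliquesP; rewrite cardsU1 xK Ks subUset sub1set xA; split=> //.
    by apply/subsetP => y /KN; rewrite inE => /andP[].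
  by apply: cliqueU1 => // y /KN; rewrite inE => /andP[].
by rewrite As inE.
Qed.

Lemma card_cliques_at A x t :
  #|[set K in cliques A t.+1 | x \in K]| <= #|cliques (nbrs A x) t|.
Proof.
rewrite -(@card_in_imset _ _ (fun K : {set T} => K :\ x)); last first.
  move=> K S; rewrite !inE => /andP[_ xK] /andP[_ xS] KS.
  by rewrite -(setD1K xK) KS setD1K.
apply/subset_leq_card/subsetP => S /imsetP[K].
rewrite inE => /andP[/cliquesP[/subsetP KA Kt Kcl] xK] ->.
apply/cliquesP; split.
- apply/subsetP => y /setD1P[yx yK]; rewrite inE KA //=.
  by move/cliqueP: Kcl => Kcl; apply: Kcl => //; rewrite eq_sym.
- by move: Kt; rewrite (cardsD1 x) xK add1n => -[].
- by apply: clique_sub Kcl; apply: subD1set.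
Qed.

(** Weighted arithmetic-geometric mean inequality. The induction multiplies the previous case by [b]
    and adds [t.+1] times [z ^ t * (z - b) ^ 2]. *)
Lemma amgm (R : realFieldType) (z b : R) t : (0 <= z)%R -> (0 <= b)%R ->
  (t.+1%:R * b * z ^+ t <= b ^+ t.+1 + t%:R * z ^+ t.+1)%R.
Proof.
move=> z0 b0; elim: t => [|t IH]; first by rewrite expr0 expr1 mul0r addr0 mulr1 mul1r.
have h1 := ler_wpM2l b0 IH.
have h2 : (0 <= t.+1%:R * (z ^+ t * (z - b) ^+ 2))%R.
  by apply: mulr_ge0; [exact: ler0n|apply: mulr_ge0; [exact: exprn_ge0|exact: sqr_ge0]].
rewrite (exprS b t.+1) (exprS z t.+1) !(exprS z t) in h1 *.
rewrite -!(natr1 t.+1) -!(natr1 t) in h1 h2 *.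
move: (z ^+ t)%R (b ^+ t.+1)%R (t%:R)%R h1 h2 => u v w h1 h2.
nra.
Qed.

(** Induction step of Zykov's bound: [a] and [d] are the sizes of the vertex set and of a
    neighbourhood, [m] counts the (t+1)-cliques, and [k1], [k2] those of sizes t+1 and t inside the
    neighbourhood. The resulting bound is largest at d (s+1) = a s, the equality case of [amgm]. *)
Lemma zykov_arith (s t a d m k1 k2 : nat) : 0 < s -> d <= a ->
  s ^ t.+1 * k1 <= 'C(s, t.+1) * d ^ t.+1 ->
  s ^ t * k2 <= 'C(s, t) * d ^ t ->
  m <= k1 + (a - d) * k2 ->
  s.+1 ^ t.+1 * m <= 'C(s.+1, t.+1) * a ^ t.+1.
Proof.
move=> s0 da h1 h2 hm.
have [st|ts] := ltnP s t.
  have C1 : 'C(s, t) = 0 by apply: bin_small.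
  have C2 : 'C(s, t.+1) = 0 by apply: bin_small; lia.
  move: h1 h2; rewrite C1 C2 !mul0n !leqn0 !muln_eq0 !expn_eq0 !(gtn_eqF s0) /=.
  by move=> /eqP k10 /eqP k20; move: hm; rewrite k10 k20 muln0 leqn0 => /eqP->; rewrite muln0.
have C1 : t.+1 * 'C(s, t.+1) = (s - t) * 'C(s, t) by rewrite mul_bin_left.
have C2 : t.+1 * 'C(s.+1, t.+1) = s.+1 * 'C(s, t) by rewrite -mul_bin_diag.
have am := @amgm rat (d * s.+1)%:R (a * s)%:R t (ler0n _ _) (ler0n _ _).
have {}am : t.+1 * (a * s) * (d * s.+1) ^ t <= (a * s) ^ t.+1 + t * (d * s.+1) ^ t.+1.
  by move: am; rewrite -(ler_nat rat) natrD !(natrM, natrX).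
rewrite -(@leq_pmul2l (t.+1 * s ^ t.+1)) ?muln_gt0 ?expn_gt0 ?s0 //.
set c := 'C(s, t) in C1 C2 h2 *.
rewrite (_ : _ * ('C(s.+1, _) * _) = c * s.+1 * (a * s) ^ t.+1); last first.
  by rewrite mulnACA C2 expnMn; ring.
apply: (@leq_trans (t.+1 * s.+1 ^ t.+1 * (s ^ t.+1 * k1 + (a - d) * s * (s ^ t * k2)))).
  rewrite (_ : _ + _ = s ^ t.+1 * (k1 + (a - d) * k2)); last by rewrite expnS; ring.
  rewrite (_ : _ * _ = t.+1 * s.+1 ^ t.+1 * (s ^ t.+1 * m)); last by ring.
  by rewrite !leq_mul2l hm !orbT.
apply: (@leq_trans (t.+1 * s.+1 ^ t.+1 *
    ('C(s, t.+1) * d ^ t.+1 + (a - d) * s * (c * d ^ t)))).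
  by rewrite leq_mul2l leq_add ?orbT // leq_mul2l h2 orbT.
rewrite (_ : _ * _ = c * s.+1 * ((d * s.+1) ^ t * ((s - t) * d + t.+1 * (a - d) * s)));
  last first.
  rewrite mulnDr !mulnA (_ : t.+1 * _ * 'C(s, t.+1) = s.+1 ^ t.+1 * ((s - t) * c)).
    by rewrite expnMn !expnS; ring.
  by rewrite -C1; ring.
rewrite leq_mul2l; apply/orP; right.
(* After the common factor (d (s+1))^t is removed, what remains is the identity (s-t) d + (t+1)
   (a-d) s + t d (s+1) = (t+1) a s. *)
rewrite -(leq_add2r (t * (d * s.+1) ^ t.+1)); apply: leq_trans am.
rewrite expnS mulnA [t * _ * _]mulnC [X in _ <= X]mulnC -mulnDr leq_mul2l.
apply/orP; right; rewrite -(subnK ts) -{2}(subnK da); move: (s - t) (a - d) => p q.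
rewrite !addnK; nia.
Qed.

(* Induction on s: for x in A with the most (t-1)-cliques in its neighbourhood N,
   every t-clique lies in N, which has no (s+1)-clique, or meets A \ N. *)
Theorem zykov s t A : cliques A s.+2 = set0 ->
  s.+1 ^ t * #|cliques A t| <= 'C(s.+1, t) * #|A| ^ t.
Proof.
elim: s t A => [|s IH] [|t] A As; try by rewrite cliques0 cards1 bin0.
  rewrite exp1n mul1n; case: t => [|t]; first by rewrite bin1 mul1n card_cliques1.
  by rewrite (cliques_le As) // cards0.
have [->|[x0 x0A]] := set_0Vmem A.
  rewrite (_ : cliques _ _ = set0) ?cards0 ?muln0 //.
  apply/setP => K; rewrite in_set0; apply/negbTE/negP => /cliquesP[].
  by rewrite subset0 => /eqP->; rewrite cards0.
pose F y := #|cliques (nbrs A y) t|.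
have [x xA xmax] := @arg_maxnP _ x0 [in A] F x0A.
have Ns := nbrs_clique_free xA As.
apply: (zykov_arith (d := #|nbrs A x|) _ _ (IH _ _ Ns) (IH _ _ Ns)) => //.
  exact: subset_leq_card (nbrsS _ _).
rewrite -cardsDS ?nbrsS //.
apply: (@leq_trans (#|cliques (nbrs A x) t.+1| + #|\bigcup_(y in A :\: nbrs A x)
    [set K in cliques A t.+1 | y \in K]|)).
  apply: leq_trans (leq_card_setU _ _); apply/subset_leq_card/subsetP => K.
  move=> /[dup] KA /cliquesP[KsA Kt Kcl]; rewrite inE.
  have [KN|/subsetPn[y yK yN]] := boolP (K \subset nbrs A x).
    by apply/orP; left; apply/cliquesP.
  apply/orP; right; apply/bigcupP; exists y; last by rewrite inE KA.
  by rewrite inE yN (subsetP KsA).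
rewrite leq_add2l (leq_trans (card_bigcup_le _ _)) // -sum_nat_const leq_sum // => y.
rewrite inE => /andP[_ yA]; exact: leq_trans (card_cliques_at _ _ _) (xmax y yA).
Qed.

End Cliques.

(** * Cancellative set systems *)

Section Cancellative.
Variables (T : finType) (e : rel T).
Hypotheses (e_sym : symmetric e) (e_irr : irreflexive e).
Implicit Types (A K S Q : {set T}) (x y : T) (E : {set {set T}}).

Definition link E x := [set S : {set T} | (x \notin S) && (x |: S \in E)].

(** The graph [e] is fixed independently of [E], so that links and subfamilies of [E] are
    cancellative over the same graph. *)
Definition cancellative k E :=
  [/\ {in E, forall K, #|K| = k}, {in E, forall K, clique e K} &
      forall x y S, e x y -> S \in link E x -> S \notin link E y].

Lemma card_link E x : #|link E x| = #|[set K in E | x \in K]|.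
Proof.
rewrite -(@card_in_imset _ _ (fun S => x |: S) (link E x)); last first.
  move=> S K; rewrite !inE => /andP[xS _] /andP[xK _] SK.
  by rewrite -(setU1K xS) SK setU1K.
apply: eq_card => K; rewrite inE; apply/imsetP/andP.
  by case=> S; rewrite inE => /andP[_ SE] ->; rewrite SE setU11.
case=> KE xK; exists (K :\ x); last by rewrite setD1K.
by rewrite inE setD11 setD1K.
Qed.

Lemma link_cliques k E A x : cancellative k.+1 E -> {in E, forall K, K \subset A} ->
  link E x \subset cliques e (nbrs e A x) k.
Proof.
case=> Ek Ecl _ EA; apply/subsetP => S; rewrite inE => /andP[xS SE].
apply/cliquesP; split.
- apply/subsetP => y yS; rewrite inE (subsetP (EA _ SE)) ?setU1r //=.
  apply: (cliqueP _ _ (Ecl _ SE)); rewrite ?setU11 ?setU1r //.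
  by apply: contraNneq xS => ->.
- by have := Ek _ SE; rewrite cardsU1 xS => -[].
- exact: clique_sub (subsetUr _ _) (Ecl _ SE).
Qed.

(** A set [S] in the links of adjacent [y] and [z] inside the link of [x] would put [x |: S] in the
    links of both in [E]. *)
Lemma link_cancellative k E x : cancellative k.+1 E -> cancellative k (link E x).
Proof.
move=> Ec; have /subsetP lk := link_cliques x Ec (fun K _ => subsetT K).
have [Ek Ecl Ed] := Ec; split=> [K /lk /cliquesP[] //|K /lk /cliquesP[] //|].
move=> y z S yz.
have linkP w : S \in link (link E x) w ->
    x |: S \in link E w.
  rewrite inE => /andP[wS]; rewrite inE => /andP[].
  rewrite in_setU1 negb_or => /andP[xw xS] xwS.
  by rewrite inE in_setU1 eq_sym negb_or xw wS setUCA.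
move=> /linkP Sy; apply/negP => /linkP Sz.
by move/negP: (Ed _ _ _ yz Sy).
Qed.

Lemma sub_cancellative k E E' : E' \subset E -> cancellative k E -> cancellative k E'.
Proof.
move=> /subsetP E'E [Ek Ecl Ed]; split=> [K /E'E /Ek|K /E'E /Ecl|] // x y S xy.
have sub z : S \in link E' z -> S \in link E z.
  by rewrite !inE => /andP[-> /E'E].
by move=> /sub Sx; apply: contra (@sub y) (Ed _ _ _ xy Sx).
Qed.

Lemma links_disjoint k E Q x y S : cancellative k E -> clique e Q ->
  x \in Q -> y \in Q -> S \in link E x -> S \in link E y -> x = y.
Proof.
move=> [_ _ Ed] /cliqueP Qcl xQ yQ Sx Sy; apply/eqP/negPn/negP => xy.
by move/negP: (Ed _ _ _ (Qcl _ _ xQ yQ xy) Sx).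
Qed.

Lemma sum_link_clique k E A Q : cancellative k.+1 E -> {in E, forall K, K \subset A} ->
  clique e Q -> \sum_(x in Q) #|link E x| <= #|cliques e A k|.
Proof.
move=> Ec EA Qcl; apply: sum_card_disjoint => [x xQ|x y S]; last exact: (links_disjoint Ec).
apply/subsetP => S /(subsetP (link_cliques x Ec EA)) /cliquesP[SA Sk Scl].
by apply/cliquesP; split=> //; apply: subset_trans SA (nbrsS _ _ _).
Qed.

(** [Q] is a clique of maximum size in [A]; it need not contain [K], which only ensures t <= s. *)
Lemma max_clique A t K : K \in cliques e A t ->
  exists s Q, [/\ t <= s, Q \in cliques e A s & cliques e A s.+1 = set0].
Proof.
case/cliquesP => KA Kt Kcl.
have K0 : (K \subset A) && clique e K by rewrite KA.
have [Q /andP[QA Qcl] Qmax] := @arg_maxnP _ K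
  (fun Q : {set T} => (Q \subset A) && clique e Q) (fun Q => #|Q|) K0.
exists #|Q|, Q; split; first by rewrite -Kt; apply: Qmax.
  exact/cliquesP.
apply/setP => L; rewrite in_set0; apply/negbTE/negP => /cliquesP[LA Ls Lcl].
by have := Qmax L; rewrite LA Lcl Ls /= ltnn => /(_ isT).
Qed.

Lemma clique_min_degree k E A Q s d : cancellative k.+1 E ->
  {in E, forall K, K \subset A} -> Q \in cliques e A s ->
  {in Q, forall x, d <= #|link E x|} -> s * d <= #|cliques e A k|.
Proof.
move=> Ec EA /cliquesP[QA <- Qcl] Qd; apply: leq_trans (sum_link_clique Ec EA Qcl).
by rewrite -sum_nat_const leq_sum.
Qed.

(* Some vertex of a maximal clique lies in at most |A|^2/9 members; delete it. *)
Theorem cancellative3_bound E A : cancellative 3 E -> {in E, forall K, K \subset A} ->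
  54 * #|E| <= #|A| * #|A|.+1 * (2 * #|A|).+1.
Proof.
have [a] := ubnP #|A|; elim: a A E => // a IH A E Aa Ec EA.
have [->|[K0 K0E]] := set_0Vmem E; first by rewrite cards0 muln0.
have [Ek Ecl _] := Ec.
have K0A : K0 \in cliques e A 3 by apply/cliquesP; split; [exact: EA|exact: Ek|exact: Ecl].
have [s' [Q [s3 QA As]]] := max_clique K0A.
case: s' s3 QA As => // s s3 /[dup] QA /cliquesP[QsA Qs Qcl] As.
have [x0 x0Q] : exists x, x \in Q by apply/set0Pn; rewrite -card_gt0 Qs.
have [x xQ xmin] := @arg_minnP _ x0 [in Q] (fun x => #|link E x|) x0Q.
have xA := subsetP QsA _ xQ.
have h1 := clique_min_degree Ec EA QA xmin.
have := zykov e_sym e_irr 2 As; rewrite bin2 -pred_Sn => h2.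
have E2 : (s.+1 * s)./2 * 2 = s.+1 * s.
  by rewrite muln2 halfK oddM /= andNb subn0.
have h3 : 9 * #|link E x| <= #|A| ^ 2.
  set l := #|link E x| in h1 *; set b := #|A| in h2 *.
  have h4 : s.+1 ^ 2 * (s.+1 * l) * 2 <= s.+1 * s * b ^ 2.
    apply: (@leq_trans (s.+1 ^ 2 * #|cliques e A 2| * 2)).
      by rewrite leq_mul2r leq_mul2l h1 !orbT.
    by rewrite -E2 [leqRHS]mulnAC leq_mul2r h2 orbT.
  have {}h4 : 2 * s.+1 ^ 2 * l <= s * b ^ 2.
    rewrite -(@leq_pmul2l s.+1) //; move: h4; rewrite !expnS; clear; lia.
  rewrite -(@leq_pmul2l (2 * s.+1 ^ 2)) //.
  apply: (@leq_trans (9 * s * b ^ 2)); first by rewrite mulnAC; clear -h4; lia.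
  (* Here 2 (s+1)^2 - 9 s = (2s-1) (s-2), and s >= 2. *)
  rewrite leq_mul2r; apply/orP; right; clear -s3; nia.
pose E' := [set K in E | x \notin K].
have E'E : E' \subset E by apply/subsetP => K; rewrite inE => /andP[].
have E'A : {in E', forall K, K \subset A :\ x}.
  by move=> K; rewrite inE => /andP[KE xK]; rewrite subsetD1 EA.
have := IH _ _ _ (sub_cancellative E'E Ec) E'A.
have A1 : #|A| = #|A :\ x|.+1 by rewrite (cardsD1 x) xA.
have -> : #|E| = #|link E x| + #|E'|.
  rewrite card_link -(cardsID [set K : {set T} | x \in K]); congr (_ + _); apply: eq_card => K.
    by rewrite !inE.
  by rewrite !inE andbC.
(* The product a (a+1) (2a+1) is six times the sum of the squares up to a, so removing [x] lowers it
   by 6 a^2, which by [h3] pays for 54 times the link of [x]. *)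
rewrite A1 in h3 Aa *; move=> /(_ Aa); clear -h3; nia.
Qed.

(* In the proof, V i consists of the vertices that can replace i in Q, and W of
   those in no V i. A vertex u has no neighbour in some V i, since otherwise its link
   would be almost disjoint from all the links of Q. The link of u is then close to
   that of i: a (k+1)-clique in the links of u and of another j in Q avoids V i and V j,
   and as the V l are independent, it meets W. *)
Lemma partition_of_links k E Q (delta eta D w p : nat) :
  cancellative k.+2 E -> cliques e [set: T] k.+3 = set0 -> Q \in E ->
  (forall x, delta <= #|link E x|) ->
  #|cliques e [set: T] k.+1| <= k.+2 * delta + eta ->
  (forall x, D <= #|nbrs e [set: T] x|) ->
  #|T| * k.+1 <= k.+2 * D + w ->
  (forall x, #|cliques e (nbrs e [set: T] x) k| <= p) ->
  k.+3 * eta < delta -> 3 * eta + 2 * (w * p) < delta ->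
  exists c : T -> T, (forall x, c x \in Q) /\ (forall x y, e x y -> c x != c y).
Proof.
move=> Ec Tk QE degE Kle degG Tw Np eta1 eta2.
have [Ek Ecl Ed] := Ec; have Qk := Ek _ QE; have Qcl := Ecl _ QE.
have no_clique K : clique e K -> #|K| = k.+3 -> False.
  move=> Kcl Kk; have : K \in cliques e [set: T] k.+3 by apply/cliquesP; rewrite subsetT.
  by rewrite Tk inE.
pose V i := [set x | [forall j in Q :\ i, e j x]].
have VP i x : x \in V i -> {in Q :\ i, forall j, e j x} by rewrite inE => /forall_inP.
have Vcl i x : i \in Q -> x \in V i -> clique e (x |: (Q :\ i)).
  move=> iQ xi; apply: cliqueU1 => //; first exact: clique_sub (subD1set _ _) Qcl.
  by move=> j jQ; rewrite e_sym; apply: VP jQ.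
have Vk i x : i \in Q -> x \in V i -> #|x |: (Q :\ i)| = k.+2.
  move=> iQ xi; rewrite cardsU1 (_ : x \notin _).
    by rewrite -Qk (cardsD1 i Q) iQ.
  by apply/negP => /(VP _ _ xi); rewrite e_irr.
have Vindep i x y : i \in Q -> x \in V i -> y \in V i -> ~~ e x y.
  move=> iQ xi yi; apply/negP => xy.
  apply: (@no_clique (y |: (x |: (Q :\ i)))).
    apply: cliqueU1 => [//||z]; first exact: Vcl.
    by case/setU1P => [->|zQ]; rewrite e_sym //; apply: VP zQ.
  rewrite cardsU1 Vk // (_ : y \notin _) //.
  apply/negP => /setU1P[yx|/(VP _ _ yi)]; last by rewrite e_irr.
  by move: xy; rewrite yx e_irr.
have Vself i x : i \in Q -> x \in V i -> ~~ e i x.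
  move=> iQ; apply: Vindep => //; rewrite inE; apply/forall_inP => j /setD1P[ji jQ].
  exact: (cliqueP _ _ Qcl).
pose W := ~: \bigcup_(i in Q) V i.
(* Degrees are summed over [Q]: without (k+3)-cliques a vertex has at most k+1 neighbours in [Q],
   and a vertex of [W] has at most k. *)
have Ww : #|W| <= w.
  have hs : \sum_(i in Q) #|nbrs e [set: T] i| + #|W| <= #|T| * k.+1.
    rewrite (@sum_card_exchange _ _ _ _ [set: T]) => [|i _]; last exact: subsetT.
    rewrite -[X in _ + X]sum1_card [X in _ + X]big_mkcond /=.
    rewrite (eq_bigl xpredT) => [|x]; last by rewrite inE.
    rewrite -big_split /= -sum_nat_const leq_sum // => x _.
    set J := [set i | _]; have JQ : J \subset Q by apply/subsetP => i; rewrite inE => /andP[].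
    have Jx i : i \in J -> e i x by rewrite inE => /andP[_]; rewrite !inE.
    have [i iQ iJ] : exists2 i, i \in Q & i \notin J.
      apply/subsetPn/negP => QJ; apply: (@no_clique (x |: Q)).
        apply: cliqueU1 => // i iQ; rewrite e_sym; apply: Jx; exact: subsetP iQ.
      rewrite cardsU1 Qk (_ : x \notin Q) //.
      by apply/negP => /(subsetP QJ)/Jx; rewrite e_irr.
    have JQi : J \subset Q :\ i by rewrite subsetD1 JQ.
    have cQi : #|Q :\ i| = k.+1 by move: Qk; rewrite (cardsD1 i) iQ add1n => -[].
    case: ifP => [xW|_]; last by rewrite addn0 -cQi subset_leq_card.
    have [j jQ jJ] : exists2 j, j \in Q :\ i & j \notin J.
      apply/subsetPn/negP => QJ; move: xW; rewrite inE => /negP; apply.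
      apply/bigcupP; exists i => //; rewrite inE; apply/forall_inP => j jQ.
      by apply: Jx; apply: subsetP jQ.
    rewrite addn1 ltnS; move: cQi; rewrite (cardsD1 j) jQ add1n => -[<-].
    by rewrite subset_leq_card // subsetD1 JQi.
  have hD : k.+2 * D <= \sum_(i in Q) #|nbrs e [set: T] i|.
    by rewrite -Qk -sum_nat_const leq_sum.
  lia.
have sub_nbr x S : S \in link E x -> {in S, forall y, e x y}.
  move=> /(subsetP (link_cliques x Ec (fun K _ => subsetT K)))/cliquesP[/subsetP Sx _ _] y.
  by move/Sx; rewrite inE => /andP[].
have linkT x S : S \in link E x -> S \in cliques e [set: T] k.+1.
  move=> /(subsetP (link_cliques x Ec (fun K _ => subsetT K)))/cliquesP[_ ? ?].
  by apply/cliquesP; rewrite subsetT.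
(* The (k+1)-cliques that the links over [K] miss. If [K] is a (k+2)-clique, these links are
   disjoint and of size at least [delta], so at most [eta] are missed. *)
pose U K := cliques e [set: T] k.+1 :\: \bigcup_(x in K) link E x.
have Ueta K : clique e K -> #|K| = k.+2 -> #|U K| <= eta.
  move=> Kcl Kk; have h : k.+2 * delta <= #|\bigcup_(x in K) link E x|.
    apply: (@leq_trans (\sum_(x in K) #|link E x|)).
      by rewrite -Kk -sum_nat_const leq_sum.
    apply: sum_card_disjoint => [x xK|x y S]; first exact: bigcup_sup.
    exact: (links_disjoint Ec).
  have bT : \bigcup_(x in K) link E x \subset cliques e [set: T] k.+1.
    by apply/bigcupsP => x _; apply/subsetP => S; apply: linkT.
  by rewrite cardsDS //; lia.
have Vlink i x : i \in Q -> x \in V i -> #|link E i :\: link E x| <= eta.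
  move=> iQ xi; apply: leq_trans (Ueta _ (Vcl _ _ iQ xi) (Vk _ _ iQ xi)).
  apply/subset_leq_card/subsetP => S /setDP[Si Sx]; rewrite inE (linkT _ _ Si) andbT.
  apply/negP => /bigcupP[j /setU1P[->|/setD1P[ji jQ]]]; first exact/negP.
  by move=> Sj; rewrite (links_disjoint Ec Qcl jQ iQ Sj Si) eqxx in ji.
have colour u : exists i, (i \in Q) && [forall x in V i, ~~ e u x].
  apply/existsP; apply: contraT => /existsPn h; exfalso.
  have [f fP] : exists f : T -> T, {in Q, forall i, f i \in V i /\ e u (f i)}.
    exists (fun i => odflt u [pick x in V i | e u x]) => i iQ.
    case: pickP => [x /andP[] //|nx].
    have := h i; rewrite iQ => /forall_inP[] x xi; apply/negP => ux.
    by have := nx x; rewrite xi ux.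
  suff : #|link E u| <= k.+3 * eta by have := degE u; lia.
  (* One [eta] comes from [U Q] and one from each of the k+2 vertices of [Q], as the link of [u] is
     disjoint from that of its neighbour [f i]. *)
  apply: (@leq_trans (#|U Q| + #|\bigcup_(i in Q) (link E i :\: link E (f i))|)).
    apply: leq_trans (leq_card_setU _ _); apply/subset_leq_card/subsetP => S Su.
    rewrite in_setU in_setD (linkT _ _ Su) andbT.
    case: (boolP (S \in \bigcup_(i in Q) link E i)) => //= /bigcupP[i iQ Si].
    apply/bigcupP; exists i => //; rewrite in_setD Si andbT.
    exact: Ed (fP _ iQ).2 Su.
  rewrite mulSn leq_add ?Ueta // (leq_trans (card_bigcup_le _ _)) //.
  by rewrite -Qk -sum_nat_const leq_sum // => i iQ; apply: Vlink (fP _ iQ).1.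
pose c u := xchoose (colour u).
have cQ u : c u \in Q by case/andP: (xchooseP (colour u)).
have cV u x : x \in V (c u) -> ~~ e u x.
  by case/andP: (xchooseP (colour u)) => _ /forall_inP; apply.
exists c; split=> // u v uv; apply/negP => /eqP cuv.
pose Wcl := \bigcup_(y in W) [set K in cliques e [set: T] k.+1 | y \in K].
have Wclw : #|Wcl| <= w * p.
  apply: (@leq_trans (\sum_(y in W) p)); last by rewrite sum_nat_const leq_mul2r Ww orbT.
  apply: leq_trans (card_bigcup_le _ _) _; rewrite leq_sum // => y _.
  exact: leq_trans (card_cliques_at _ _ _ _) (Np y).
have close x : delta <= #|link E x :&: link E (c x)| + eta + w * p.
  apply: leq_trans (degE x) _; rewrite -(cardsID (link E (c x)) (link E x)) -addnA leq_add2l.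
  apply: leq_trans (leq_add (Ueta Q Qcl Qk) Wclw); apply: leq_trans (leq_card_setU _ _).
  apply/subset_leq_card/subsetP => S /setDP[Sx Sc]; rewrite in_setU in_setD (linkT _ _ Sx) andbT.
  case: (boolP (S \in \bigcup_(i in Q) link E i)) => //= /bigcupP[j jQ Sj].
  have jc : j != c x by apply: contraNneq Sc => <-.
  apply/bigcupP.
  have [|/subsetPn[y yS yW]] := boolP (S \subset \bigcup_(i in Q) V i); last first.
    by exists y; [rewrite in_setC | rewrite inE (linkT _ _ Sx)].
  (* If [S] missed [W], its k+1 pairwise adjacent vertices would lie in distinct sets [V l] with l
     in [Q] other than [c x] and [j], which leaves only k choices. *)
  move=> SV; exfalso.
  pose f y := odflt j [pick i in Q | y \in V i].
  have fP y : y \in S -> f y \in Q /\ y \in V (f y).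
    move=> yS; rewrite /f; case: pickP => [i /andP[] //|ny].
    by have /bigcupP[i iQ yi] := subsetP SV _ yS; have := ny i; rewrite iQ yi.
  have /cliquesP[_ Sk /cliqueP Scl] := linkT _ _ Sx.
  have finj : {in S &, injective f}.
    move=> y z yS zS fyz; apply/eqP/negPn/negP => yz.
    have [fQ yf] := fP _ yS; have [_ zf] := fP _ zS.
    by rewrite -fyz in zf; move/negP: (Vindep _ _ _ fQ yf zf); rewrite Scl.
  have fS : f @: S \subset Q :\ c x :\ j.
    apply/subsetP => _ /imsetP[y yS ->]; have [fQ yf] := fP _ yS; rewrite !inE fQ andbT.
    apply/andP; split; apply/eqP => fy; rewrite fy in yf.
      by have := Vself _ _ jQ yf; rewrite (sub_nbr _ _ Sj).
    by have := cV _ _ yf; rewrite (sub_nbr _ _ Sx).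
  move: (subset_leq_card fS) Qk; rewrite (card_in_imset finj) Sk.
  rewrite (cardsD1 (c x) Q) cQ (cardsD1 j (Q :\ c x)) in_setD1 jc jQ /=.
  by rewrite !add1n => h [mk]; rewrite mk ltnn in h.
have hi : #|link E (c u)| <= delta + eta.
  have := leq_trans (sum_link_clique Ec (fun K _ => subsetT K) Qcl) Kle.
  rewrite (big_setD1 (c u)) //=.
  have : k.+1 * delta <= \sum_(i in Q :\ c u) #|link E i|.
    rewrite (_ : k.+1 = #|Q :\ c u|) -?sum_nat_const ?leq_sum //.
    by move: Qk; rewrite (cardsD1 (c u)) cQ add1n => -[].
  rewrite [k.+2 * _]mulSn; move: (\sum_(i in Q :\ c u) _) => m.
  clear; lia.
(* The links of [u] and [v] are disjoint, and each takes at least delta - eta - w p out of the link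
   of their common colour, whose size is at most delta + eta. This contradicts [eta2]. *)
have : #|link E u :&: link E (c u)| + #|link E v :&: link E (c u)| <= #|link E (c u)|.
  rewrite -cardsUI (_ : _ :&: (link E v :&: _) = set0) ?cards0 ?addn0.
    by rewrite subset_leq_card // subUset !subsetIr.
  apply/setP => S; rewrite in_set0; apply/negbTE/negP.
  by case/setIP => /setIP[Su _] /setIP[Sv _]; have := Ed _ _ _ uv Su; rewrite Sv.
have := close u; have := close v; rewrite -cuv.
lia.
Qed.

End Cancellative.

(** * Uniformities three and four *)

Section Partite.
Variables (T : finType) (e : rel T).
Hypotheses (e_sym : symmetric e) (e_irr : irreflexive e).
Implicit Types (A K S Q : {set T}) (x y : T) (E : {set {set T}}).

Lemma exists_edge E d : 0 < #|T| -> 0 < d -> (forall x, d <= #|link E x|) ->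
  exists K, K \in E.
Proof.
move=> /card_gt0P[x _] d0 /(_ x) /(leq_trans d0) /card_gt0P[S].
by rewrite inE => /andP[_ SE]; exists (x |: S).
Qed.

Lemma min_nbrs : 0 < #|T| ->
  exists x0, forall x, #|nbrs e [set: T] x0| <= #|nbrs e [set: T] x|.
Proof.
move=> /card_gt0P[x _].
have [x0 _ h] := @arg_minnP _ x xpredT (fun x => #|nbrs e [set: T] x|) isT.
by exists x0 => y; apply: h.
Qed.

Lemma link_cliquesT k E x : cancellative e k.+1 E ->
  #|link E x| <= #|cliques e (nbrs e [set: T] x) k|.
Proof. by move=> Ec; apply/subset_leq_card/link_cliques => // K; rewrite subsetT. Qed.

(** The constant 11/100 lies below 1/9, the value of the balanced complete tripartite 3-graph, and
    above 3/32, up to which Zykov's bound permits clique number 4. *)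
Theorem tripartite E d : cancellative e 3 E -> 0 < #|T| ->
  (forall x, d <= #|link E x|) -> 11 * #|T| ^ 2 <= 100 * d ->
  exists Q (c : T -> T), [/\ Q \in E, forall x, c x \in Q &
    forall x y, e x y -> c x != c y].
Proof.
move=> Ec T0 degE hd.
have d0 : 0 < d by nia.
have [Ek Ecl _] := Ec.
have [K KE] := exists_edge T0 d0 degE.
have [s' [Q [s3 QA As]]] := @max_clique _ e [set: T] 3 K
  (introT (cliquesP _ _ _ _) (And3 (subsetT K) (Ek _ KE) (Ecl _ KE))).
have h1 := clique_min_degree Ec (fun K _ => subsetT K) QA (fun x _ => degE x).
have s_eq : s' = 3.
  case: s' s3 As h1 {QA} => // s s3 As h1.
  have := zykov e_sym e_irr 2 As; rewrite cardsT.
  have := mul_bin_left s.+1 1; rewrite bin1 subn1 /= => C2 h2.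
  move: #|cliques e _ 2| ('C(_, _)) h1 h2 C2 hd => k b h1 h2 C2 hd.
  have h3 : 100 * (2 * (s.+1 ^ 2 * (s.+1 * d))) <= 100 * (s * s.+1 * #|T| ^ 2).
    rewrite leq_mul2l /= -C2 -[2 * b * _]mulnA leq_mul2l /=.
    by apply: leq_trans h2; rewrite leq_mul2l h1 orbT.
  have h4 : 22 * s.+1 ^ 3 * #|T| ^ 2 <= 100 * s * s.+1 * #|T| ^ 2.
    apply: leq_trans (_ : 2 * s.+1 ^ 3 * (100 * d) <= _).
      by rewrite (_ : 22 * _ * _ = 2 * s.+1 ^ 3 * (11 * #|T| ^ 2)) ?leq_mul2l ?hd ?orbT //; ring.
    by move: h3; rewrite !expnS; clear; lia.
  move: h4; rewrite leq_mul2r expn_eq0 (gtn_eqF T0) /= => h4.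
  (* This holds for s = 2 but fails from s = 3 on. *)
  have {}h4 : 22 * s.+1 ^ 2 <= 100 * s.
    by rewrite -(@leq_pmul2r s.+1) //; move: h4; rewrite !expnS; clear; lia.
  by clear -s3 h4; nia.
rewrite {}s_eq {s3 QA h1} in As.
have hk : 3 * #|cliques e [set: T] 2| <= #|T| ^ 2.
  by have := zykov e_sym e_irr 2 As; rewrite cardsT (_ : 'C(3, 2) = 3) //; clear; lia.
have [x0 x0min] := min_nbrs T0.
(* The neighbourhood of [x0] is triangle-free, so Mantel's bound gives 4 d <= D^2; and .663^2 <
   .44. *)
have hD : 663 * #|T| <= 1000 * #|nbrs e [set: T] x0|.
  have := leq_trans (degE x0) (link_cliquesT x0 Ec).
  have := zykov e_sym e_irr 2 (nbrs_clique_free e_sym e_irr (in_setT x0) As).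
  by rewrite binn mul1n; clear -hd T0; nia.
have hp x : #|cliques e (nbrs e [set: T] x) 1| <= #|T|.
  by apply: leq_trans (card_cliques1 _ _) _; apply: max_card.
set k := #|cliques e _ 2| in hk; set D := #|nbrs e _ _| in x0min hD.
(* With n vertices, these choices satisfy eta <= n^2/300 and w <= 11 n/1000. *)
have := @partition_of_links _ _ e_sym e_irr 1 E K d (k - 3 * d) D (#|T| * 2 - 3 * D) #|T|
  Ec As KE degE _ x0min _ hp.
case.
- by rewrite -/k; clear; lia.
- by clear; lia.
- by clear -hk hd d0; lia.
- have : (#|T| * 2 - 3 * D) * #|T| * 1000 <= 11 * #|T| ^ 2.
    by rewrite mulnAC [11 * _]mulnA leq_mul2r; apply/orP; right; clear -hD; lia.
  by clear -hk hd d0 T0; lia.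
by move=> c [cQ ce]; exists K, c.
Qed.


Lemma sum_edges_link E (g : T -> nat) :
  \sum_(K in E) \sum_(x in K) g x = \sum_x #|link E x| * g x.
Proof.
rewrite (exchange_big_dep xpredT) //=; apply: eq_bigr => x _.
by rewrite card_link -sum_nat_const; apply: eq_bigl => K; rewrite inE.
Qed.

Lemma sum_cliques_nbrs k :
  k.+1 * #|cliques e [set: T] k.+1| <= \sum_x #|cliques e (nbrs e [set: T] x) k|.
Proof.
apply: (@leq_trans (\sum_x #|[set K in cliques e [set: T] k.+1 | x \in K]|)); last first.
  by rewrite leq_sum // => x _; apply: card_cliques_at.
rewrite (@sum_card_exchange _ _ _ _ (cliques e [set: T] k.+1)) => [|x _]; last first.
  by apply/subsetP => K; rewrite inE => /andP[].
rewrite mulnC -sum_nat_const leq_sum // => K KT.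
have /cliquesP[_ Kk _] := KT; rewrite -{1}Kk; apply/subset_leq_card/subsetP => x xK.
by rewrite in_set /=; apply/setIdP.
Qed.

Definition common K := [set u | [forall x in K, e x u]].

Lemma common_codegree K : #|T| <= #|common K| + \sum_(x in K) (#|T| - #|nbrs e [set: T] x|).
Proof.
rewrite -{1}cardsT -(cardsID (common K) [set: T]) leq_add //.
  by rewrite subset_leq_card // subsetIr.
apply: leq_trans (_ : \sum_(x in K) #|~: nbrs e [set: T] x| <= _); last first.
  by apply: leq_sum => x _; rewrite -(cardsC (nbrs e [set: T] x)) addKn.
apply: leq_trans (card_bigcup_le _ _); apply/subset_leq_card/subsetP => u.
rewrite !inE andbT => /forall_inPn[x xK xu]; apply/bigcupP; exists x => //.
by rewrite !inE.
Qed.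

(* A (k+2)-clique contains at most one member of E: two members would arise from
   a common k-set by adding two vertices of the clique, which are adjacent. *)
Lemma sum_common k E : cancellative e k.+1 E ->
  \sum_(K in E) #|common K| <= #|cliques e [set: T] k.+2|.
Proof.
move=> [Ek Ecl Ed].
have commP K u : u \in common K -> {in K, forall x, e x u}.
  by rewrite inE => /forall_inP.
have commN K u : u \in common K -> u \notin K.
  by move/commP => h; apply/negP => /h; rewrite e_irr.
pose F K := [set u |: K | u in common K].
rewrite (eq_bigr (fun K => #|F K|)) => [|K KE]; last first.
  rewrite card_in_imset // => u v /commN uK /commN vK uv.
  by have := setU11 u K; rewrite uv => /setU1P[//|]; move/negP: uK.
apply: sum_card_disjoint => [K KE|K L M KE LE /imsetP[u uK ->] /imsetP[v vL uv]].
  apply/subsetP => _ /imsetP[u uK ->]; apply/cliquesP.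
  rewrite subsetT cardsU1 (commN _ _ uK) (Ek _ KE); split=> //.
  apply: cliqueU1 => // [|x xK]; first exact: Ecl.
  by rewrite e_sym; apply: commP uK _ xK.
have [uv'|uv'] := eqVneq u v.
  by rewrite -(setU1K (commN _ _ uK)) uv uv' setU1K // commN.
have vK : v \in K.
  by have := setU11 v L; rewrite -uv => /setU1P[vu|//]; rewrite vu eqxx in uv'.
(* As L = u + (K - v), the set K - v lies in the links of both [u] and [v], which are adjacent. *)
have Sv : K :\ v \in link E v by rewrite inE setD11 setD1K.
have := Ed _ _ _ (commP _ _ uK _ vK) Sv; rewrite inE negb_and.
rewrite in_setD1 (negbTE (commN _ _ uK)) andbF /=.
suff -> : u |: K :\ v = L by rewrite LE.
rewrite -(setU1K (commN _ _ vL)) -uv; apply/setP => x; rewrite !inE.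
by case: (eqVneq x u) => [->|] //=; rewrite uv'.
Qed.

(** Comparing cubic terms alone would give D above .748 n; the value 26/35 together with n >= 100
    absorbs the lower-order terms. *)
Lemma nbrs_arith (n D : nat) : 100 <= n -> 35 * D < 26 * n ->
  54 * 3 * n ^ 3 <= 193 * (D * D.+1 * (2 * D).+1) -> False.
Proof.
move=> n0 /ltnW hD h.
have h1 := leq_mul hD hD; have h2 := leq_mul h1 hD.
have h3 : 100 * (n * n) <= n * (n * n) by rewrite leq_mul2r n0 orbT.
have h4 : 100 * n <= n * n by rewrite leq_mul2r n0 orbT.
rewrite !expnS in h; lia.
Qed.

(* Scaled so that the number of vertices is [5 * a]. *)
Lemma no_clique5_arith (R : realFieldType) (a X d c5 m : R) : (0 < a ->
  375 * a ^+ 3 <= 193 * d ->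
  7 * (40 * d) <= 61 * (a * X) - 650 * a ^+ 3 ->
  7 * (d * X) - 130 * (d * a ^+ 2) - a * m <= 7 * c5 ->
  m <= 5 * a ^+ 4 -> c5 <= a ^+ 5 -> False)%R.
Proof.
move=> a0 dn q1 q2 q3 q4.
have a3 : (0 < a ^+ 3)%R by apply: exprn_gt0.
have a2 : (0 < a ^+ 2)%R by apply: exprn_gt0.
(* [X] is the degree sum over 5 a vertices: the average degree is at least 3.9 a, which is .78 of
   the number of vertices. *)
have h1 : (39 * a ^+ 2 <= 2 * X)%R.
  rewrite -(ler_pM2l a0) mulrCA -exprS mulrCA; lra.
(* By [q2], [q3] and [q4], d (7 X - 130 a^2) is at most 12 a^5, whereas [dn] and [h1] make it at
   least (375/193) (13/2) a^5, which is larger. *)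
have h2 : (0 <= (193 * d - 375 * a ^+ 3) * (7 * X - 130 * a ^+ 2))%R.
  by apply: mulr_ge0; lra.
have h3 : (0 <= a ^+ 3 * (2 * X - 39 * a ^+ 2))%R by apply: mulr_ge0; lra.
have h4 := ler_wpM2l (ltW a0) q3.
have h5 : (0 < a ^+ 5)%R by apply: exprn_gt0.
rewrite !exprS expr0 in h2 h3 h4 h5 q2 q4; lra.
Qed.

Lemma nbrs_bound E d : cancellative e 4 E -> 100 <= #|T| ->
  (forall x, d <= #|link E x|) -> 3 * #|T| ^ 3 <= 193 * d ->
  forall x, 26 * #|T| <= 35 * #|nbrs e [set: T] x|.
Proof.
move=> Ec n0 degE hd x.
have := cancellative3_bound e_sym e_irr (link_cancellative x Ec)
  (A := nbrs e [set: T] x) _.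
have lk := subsetP (link_cliques x Ec (fun K _ => subsetT K)).
move/(_ (fun K KE => let: And3 KA _ _ := cliquesP _ _ _ _ (lk K KE) in KA)).
have := degE x; set l := #|link E x|; set D := #|nbrs _ _ _|; set n := #|T| in n0 hd *.
move=> dl hl; rewrite leqNgt; apply/negP => hD.
apply: (nbrs_arith n0 hD); apply: leq_trans (_ : 193 * (54 * l) <= _).
  by clear -hd dl; lia.
by rewrite leq_mul2l hl.
Qed.

Lemma no_clique5 (R : realFieldType) E d : cancellative e 4 E -> 100 <= #|T| ->
  (forall x, d <= #|link E x|) -> 3 * #|T| ^ 3 <= 193 * d ->
  cliques e [set: T] 6 = set0 -> 5 * d <= #|cliques e [set: T] 3| -> False.
Proof.
move=> Ec n0 degE hd T6 hk3.
have hD := nbrs_bound Ec n0 degE hd.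
pose L x := #|link E x|; pose D x := #|nbrs e [set: T] x|.
have Dn x : D x <= #|T| by apply: max_card.
have k4 := zykov e_sym e_irr 4 T6; have k5 := zykov e_sym e_irr 5 T6.
have cE : #|E| <= #|cliques e [set: T] 4|.
  apply/subset_leq_card/subsetP => K KE; have [Ek Ecl _] := Ec.
  by apply/cliquesP; split; [exact: subsetT|exact: Ek|exact: Ecl].
rewrite cardsT binn (_ : 'C(5, 4) = 5) // in k4 k5.
(* A neighbourhood of size D has no 5-clique and thus at most 3 D^2/8 edges; summing over the
   vertices counts each triangle three times. *)
have sD : 8 * #|cliques e [set: T] 3| <= \sum_x D x ^ 2.
  rewrite -(@leq_pmul2l 3) //; apply: leq_trans (_ : 8 * (3 * #|cliques e [set: T] 3|) <= _).
    by clear; lia.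
  apply: leq_trans (_ : 8 * \sum_x #|cliques e (nbrs e [set: T] x) 2| <= _).
    by rewrite leq_mul2l sum_cliques_nbrs.
  rewrite !big_distrr /= leq_sum // => x _.
  have := zykov e_sym e_irr 2 (nbrs_clique_free e_sym e_irr (in_setT x) T6).
  rewrite (_ : 'C(4, 2) = 6) // /D; move: #|cliques e _ 2| #|nbrs e _ x| => p q; clear; lia.
have sL : 4 * #|E| = \sum_x L x.
  have [Ek _ _] := Ec; rewrite mulnC -sum_nat_const.
  transitivity (\sum_(K in E) \sum_(x in K) 1).
    by apply: eq_bigr => K /Ek; rewrite sum1_card.
  by rewrite sum_edges_link; apply: eq_bigr => x _; rewrite muln1.
have sC : #|E| * #|T| <= #|cliques e [set: T] 5| + \sum_x L x * (#|T| - D x).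
  apply: leq_trans (leq_add (sum_common Ec) (leqnn _)).
  rewrite -sum_edges_link -big_split /= -sum_nat_const leq_sum // => K _.
  exact: common_codegree.
move: hk3 sD sC k4 k5 cE; set k3 := #|cliques _ _ 3|; set c4 := #|cliques _ _ 4|.
set c5 := #|cliques _ _ 5| => hk3 sD sC k4 k5 cE.
pose a : R := (#|T|%:R / 5)%R; pose X : R := (\sum_x (D x)%:R)%R.
have nE : (#|T|%:R = 5 * a)%R by rewrite mulrC divfK // pnatr_eq0.
have a0 : (0 < a)%R.
  by apply: divr_gt0; rewrite ltr0n //; apply: leq_trans n0.
have sa : (\sum_(x : T) a ^+ 2 = 5 * a ^+ 3)%R.
  by rewrite sumr_const -[(_ *+ #|_|)%R]mulr_natr nE; ring.
have D1 x : (26 * a <= 7 * (D x)%:R)%R.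
  by have := hD x; rewrite -(ler_nat R) !natrM nE -/(D x); lra.
have D2 x : ((D x)%:R <= 5 * a)%R by rewrite -nE ler_nat.
have dn : (375 * a ^+ 3 <= 193 * d%:R)%R.
  by move: hd; rewrite -(ler_nat R) natrM natrX natrM nE exprMn; lra.
(* the square lies below its chord on the range of the degrees *)
have q1 : (7 * (40 * d%:R) <= 61 * (a * X) - 650 * a ^+ 3)%R.
  apply: le_trans (_ : \sum_x 7 * (D x)%:R ^+ 2 <= _)%R.
    have h : 7 * (40 * d) <= \sum_x 7 * D x ^ 2.
      by rewrite -big_distrr leq_mul2l /=; apply: leq_trans sD; clear -hk3; lia.
    move: h; rewrite -(ler_nat R) !natrM natr_sum => /le_trans; apply.
    by apply: ler_sum => x _; rewrite natrM natrX.
  rewrite (_ : 650 * _ = 130 * (5 * a ^+ 3))%R; last by ring.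
  rewrite -sa !mulr_sumr -sumrB; apply: ler_sum => x _.
  have := mulr_ge0 (_ : 0 <= 7 * (D x)%:R - 26 * a)%R (_ : 0 <= 5 * a - (D x)%:R)%R.
  by rewrite !subr_ge0 D1 D2 => /(_ isT isT); lra.
(* The weights 7 D - 26 a are nonnegative by [D1], so each link size may be replaced by [d]. Writing
   them as 9 a - 7 (5 a - D) bounds the weighted sum through [sC]. *)
have q2 : (7 * (d%:R * X) - 130 * (d%:R * a ^+ 2) - a * #|E|%:R <= 7 * c5%:R)%R.
  have l2 : (7 * (d%:R * X) - 130 * (d%:R * a ^+ 2) <=
      \sum_x (L x)%:R * (7 * (D x)%:R - 26 * a))%R.
    rewrite (_ : 130 * (_ * _) = d%:R * (26 * a) * #|T|%:R)%R; last by rewrite nE; ring.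
    rewrite mulr_natr -sumr_const /X !mulr_sumr -sumrB; apply: ler_sum => x _.
    have := ler_wpM2r (_ : 0 <= 7 * (D x)%:R - 26 * a)%R (_ : d%:R <= (L x)%:R)%R.
    by rewrite subr_ge0 D1 ler_nat degE => /(_ isT isT); lra.
  have l3 : (4 * #|E|%:R = \sum_x (L x)%:R :> R)%R by rewrite -natr_sum -sL natrM.
  have l4 : (#|E|%:R * (5 * a) <= c5%:R + \sum_x (L x)%:R * (5 * a - (D x)%:R))%R.
    move: sC; rewrite -(ler_nat R) natrM nE natrD natr_sum.
    by under eq_bigr => x _ do rewrite natrM natrB // nE.
  have l5 : (\sum_x (L x)%:R * (7 * (D x)%:R - 26 * a) =
      9 * a * \sum_x (L x)%:R - 7 * \sum_x (L x)%:R * (5 * a - (D x)%:R))%R.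
    by rewrite !mulr_sumr -sumrB; apply: eq_bigr => x _; ring.
  by rewrite -l3 in l5; lra.
have q3 : (#|E|%:R <= 5 * a ^+ 4)%R.
  have : 125 * #|E| <= #|T| ^ 4 by clear -k4 cE; lia.
  by rewrite -(ler_nat R) natrM natrX nE exprMn; lra.
have q4 : (c5%:R <= a ^+ 5)%R.
  have : 5 ^ 5 * c5 <= #|T| ^ 5 by clear -k5; lia.
  rewrite -(ler_nat R) natrM !natrX nE exprMn ler_pM2l //.
  by apply: exprn_gt0; rewrite ltr0n.
exact: no_clique5_arith a0 dn q1 q2 q3 q4.
Qed.

(** The constant 3/193 lies below 1/64, the balanced 4-partite value, and above 5/324, up to which
    Zykov's bound permits clique number 6. *)
Theorem quadripartite E d : cancellative e 4 E -> 100 <= #|T| ->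
  (forall x, d <= #|link E x|) -> 3 * #|T| ^ 3 <= 193 * d ->
  exists Q (c : T -> T), [/\ Q \in E, forall x, c x \in Q &
    forall x y, e x y -> c x != c y].
Proof.
move=> Ec n0 degE hd.
have T0 : 0 < #|T| by apply: leq_trans n0.
have d0 : 0 < d.
  have : 0 < #|T| ^ 3 by rewrite expn_gt0 T0.
  by clear -hd; lia.
have [Ek Ecl _] := Ec.
have [K KE] := exists_edge T0 d0 degE.
have [s' [Q [s4 QA As]]] := @max_clique _ e [set: T] 4 K
  (introT (cliquesP _ _ _ _) (And3 (subsetT K) (Ek _ KE) (Ecl _ KE))).
have h1 := clique_min_degree Ec (fun K _ => subsetT K) QA (fun x _ => degE x).
have s_le : s' <= 5.
  rewrite leqNgt; apply/negP => s6.
  case: s' s4 s6 As h1 {QA} => [//|[//|s]] _ s6 As h1.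
  have := zykov e_sym e_irr 3 As; rewrite cardsT.
  have C3 : 6 * 'C(s.+2, 3) = s.+2 * s.+1 * s.
    by have := mul_bin_left s.+2 2; have := bin2 s.+2; have := mul_bin_left s.+2 1;
      rewrite bin1 subn1 /= !subSS subn0; clear; nia.
  move=> h2.
  move: #|cliques e _ 3| ('C(_, _)) h1 h2 C3 hd => k b h1 h2 C3 hd.
  have h3 : 6 * (s.+2 ^ 3 * (s.+2 * d)) <= s.+2 * s.+1 * s * #|T| ^ 3.
    rewrite -C3 -[6 * b * _]mulnA leq_mul2l /=.
    by apply: leq_trans h2; rewrite leq_mul2l h1 orbT.
  have h4 : 18 * s.+2 ^ 4 * #|T| ^ 3 <= 193 * (s.+2 * s.+1 * s) * #|T| ^ 3.
    apply: leq_trans (_ : 6 * s.+2 ^ 4 * (193 * d) <= _).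
      by rewrite (_ : 18 * _ * _ = 6 * s.+2 ^ 4 * (3 * #|T| ^ 3)) ?leq_mul2l ?hd ?orbT //; ring.
    rewrite -[193 * _ * _]mulnA; apply: leq_trans (_ : 193 * (6 * (s.+2 ^ 3 * (s.+2 * d))) <= _).
      by rewrite (expnS _ 3); clear; lia.
    by rewrite leq_mul2l h3 orbT.
  move: h4; rewrite leq_mul2r expn_eq0 (gtn_eqF T0) /= => h4.
  (* At s = 4 this fails narrowly, 3888 against 3860. It holds at s = 3, so clique number 5 has to
     be excluded by [no_clique5]. *)
  have {}h4 : 18 * s.+2 ^ 3 <= 193 * (s.+1 * s).
    by rewrite -(@leq_pmul2r s.+2) //; move: h4; rewrite !expnS; clear; lia.
  by clear -s6 h4; nia.
have s_eq : s' = 4.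
  move: s_le; rewrite leq_eqVlt => /orP[/eqP s5|]; last by clear -s4; lia.
  by rewrite s5 in As h1; have := @no_clique5 rat _ _ Ec n0 degE hd As h1.
rewrite {}s_eq {s4 QA h1 s_le} in As.
have hk : 16 * #|cliques e [set: T] 3| <= #|T| ^ 3.
  by have := zykov e_sym e_irr 3 As; rewrite cardsT (_ : 'C(4, 3) = 4) //; clear; lia.
have [x0 x0min] := min_nbrs T0.
(* The neighbourhood of [x0] has no 4-clique, so 27 d <= D^3; and 143/191 is just below the cube
   root of 81/193. *)
have hD : 143 * #|T| <= 191 * #|nbrs e [set: T] x0|.
  have := leq_trans (degE x0) (link_cliquesT x0 Ec).
  have := zykov e_sym e_irr 3 (nbrs_clique_free e_sym e_irr (in_setT x0) As).
  rewrite binn mul1n; set D := #|nbrs _ _ _|; set n := #|T| in hd * => h2 h3.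
  have h4 : 27 * 3 * n ^ 3 <= 193 * D ^ 3 by clear -h2 h3 hd; lia.
  rewrite leqNgt; apply/negP => /ltnW hD; have h5 := leq_mul (leq_mul hD hD) hD.
  have h6 : 0 < n * (n * n) by rewrite !muln_gt0 T0.
  rewrite !expnS in h4; clear -h4 h5 h6; lia.
have hp x : #|cliques e (nbrs e [set: T] x) 2| <= #|T| ^ 2.
  have := zykov e_sym e_irr 2 (nbrs_clique_free e_sym e_irr (in_setT x) As).
  rewrite (_ : 'C(3, 2) = 3) //.
  have : #|nbrs e [set: T] x| ^ 2 <= #|T| ^ 2 by rewrite leq_sqr max_card.
  by clear; lia.
set k := #|cliques e _ 3| in hk; set D := #|nbrs e _ _| in x0min hD.
(* With n vertices, these choices satisfy eta <= n^3/3088 and w <= n/191. *)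
have := @partition_of_links _ _ e_sym e_irr 2 E K d (k - 4 * d) D (#|T| * 3 - 4 * D) (#|T| ^ 2)
  Ec As KE degE _ x0min _ hp.
case.
- by rewrite -/k; clear; lia.
- by clear; lia.
- by clear -hk hd d0; lia.
- have : (#|T| * 3 - 4 * D) * #|T| ^ 2 * 191 <= #|T| ^ 3.
    rewrite mulnAC (expnS _ 2) leq_mul2r; apply/orP; right; clear -hD; lia.
  by clear -hk hd d0 T0; lia.
by move=> c [cQ ce]; exists K, c.
Qed.

End Partite.

(** * Sigma-free hypergraphs *)

Lemma edge_card r (V : finType) (H : rgraph r V) K : K \in edges H -> #|K| = r.
Proof. by move/(forall_inP (edges_uniform H))/eqP. Qed.

Lemma filtered_uniform r (V : finType) (p : pred {set V}) :
  [forall K in [set K : {set V} | (#|K| == r) && p K], #|K| == r].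
Proof. by apply/forall_inP => K; rewrite inE => /andP[]. Qed.

(** Along an injection this is an induced sub-hypergraph up to relabelling; along a map to the parts
    it is a blowup. *)
Definition pullback r (V W : finType) (f : V -> W) (H : rgraph r W) : rgraph r V :=
  RGraph (@filtered_uniform r V (fun K => f @: K \in edges H)).

Lemma pullbackE r (V W : finType) (f : V -> W) (H : rgraph r W) K :
  (K \in edges (pullback f H)) = (#|K| == r) && (f @: K \in edges H).
Proof. by rewrite inE. Qed.

Lemma pullback_subgraph r (V W : finType) (f : V -> W) (H : rgraph r W) :
  injective f -> subgraph (pullback f H) H.
Proof. by move=> f_inj; exists f => // K; rewrite pullbackE => /andP[]. Qed.

Lemma card_pullback r (V W : finType) (f : V -> W) (H : rgraph r W) : injective f ->
  #|edges (pullback f H)| = #|[set K in edges H | K \subset codom f]|.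
Proof.
move=> f_inj; rewrite -(card_imset _ (imset_inj f_inj)); apply: eq_card => K.
rewrite inE; apply/imsetP/andP => [[L]|[KH /subsetP Kf]].
  rewrite pullbackE => /andP[_ LH] ->; split=> //.
  by apply/subsetP => _ /imsetP[x _ ->]; apply: codom_f.
have fK : f @: (f @^-1: K) = K.
  apply/setP => x; apply/imsetP/idP => [[y]|xK]; first by rewrite inE => ? ->.
  by have /codomP[y xy] := Kf _ xK; exists y; rewrite // inE -xy.
exists (f @^-1: K) => //.
by rewrite pullbackE fK KH -(card_imset _ f_inj) fK (edge_card KH) eqxx.
Qed.

Lemma subgraph_trans r (U V W : finType) (F : rgraph r U) (G : rgraph r V) (H : rgraph r W) :
  subgraph F G -> subgraph G H -> subgraph F H.
Proof.
move=> [f f_inj fE] [g g_inj gE]; exists (g \o f); first exact: inj_comp.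
by move=> K /fE/gE; rewrite -imset_comp.
Qed.

Lemma subgraph_free r (F : rclass r) (V W : finType) (G : rgraph r V) (H : rgraph r W) :
  subgraph G H -> family_free F H -> family_free F G.
Proof. by move=> GH Hfree U K KF /subgraph_trans/(_ GH); apply: Hfree. Qed.

(** The map to the parts is bijective on every edge, so a vertex b of B outside C shares its part
    with some c in C. Both lie in B, or both lie in A because A contains the symmetric difference;
    either is impossible. *)
Lemma blowup_Sigma_free k (V : finType) (H : rgraph k.+1 V) :
  blowups_of_complete k.+1 k.+1 V H -> family_free (Sigma k.+1) H.
Proof.
move=> [psi psiP] U G [A [B [C [GE _ BC BCA _]]]] [f f_inj fE].
pose g := psi \o f.
have gP X : X \in edges G -> {in X &, injective g} /\ g @: X = [set: 'I_k.+1].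
  move=> XG; have := psiP (f @: X) (edge_card (fE _ XG)).
  rewrite -imset_comp inE => -[/(_ (fE _ XG)) /eqP gX _]; split.
    by apply/imset_injP; rewrite gX (edge_card XG).
  by apply/eqP; rewrite eqEcard subsetT cardsT card_ord gX /=.
have [AG BG CG] : [/\ A \in edges G, B \in edges G & C \in edges G].
  by rewrite GE !inE !eqxx !orbT.
have [b bB bC] : exists2 b, b \in B & b \notin C.
  apply/subsetPn/negP => /setIidPl BC'; move: BC.
  by rewrite BC' (edge_card BG) /=; lia.
have : g b \in g @: C by rewrite (gP _ CG).2 inE.
case/imsetP => c cC gbc.
have bA : b \in A by rewrite (subsetP BCA) // !inE bB bC.
have [cB|cB] := boolP (c \in B).
  by move: bC; rewrite ((gP _ BG).1 _ _ bB cB gbc) cC.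
have cA : c \in A by rewrite (subsetP BCA) // !inE cC cB orbT.
by move: bC; rewrite ((gP _ AG).1 _ _ bA cA gbc) cC.
Qed.

(** Members of [Sigma] have no vertex outside their three edges, so the configuration is first
    restricted to the subtype of its union. *)
Lemma Sigma_free_edges r (V : finType) (H : rgraph r V) (A B C : {set V}) :
  family_free (Sigma r) H -> A \in edges H -> B \in edges H -> C \in edges H ->
  A != B -> A != C -> B != C -> #|B :&: C| = r.-1 ->
  (B :\: C) :|: (C :\: B) \subset A -> False.
Proof.
move=> Hfree AH BH CH AB AC BC BC1 BCA.
pose X := A :|: B :|: C; pose U := {x : V | x \in X}.
pose p (K : {set V}) : {set U} := val @^-1: K.
have pK (K : {set V}) : K \subset X -> val @: p K = K.
  move=> /subsetP KX; apply/setP => x; apply/imsetP/idP => [[y]|xK].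
    by rewrite inE => ? ->.
  by exists (Sub x (KX _ xK)); rewrite ?inE /=.
have AX : A \subset X by rewrite /X -setUA subsetUl.
have BX : B \subset X by rewrite /X setUAC subsetUr.
have CX : C \subset X by rewrite /X subsetUr.
have pcard (K : {set V}) : K \subset X -> #|p K| = #|K|.
  by move=> /pK {2}<-; rewrite card_imset //; apply: val_inj.
have unif : [forall K in [set p A; p B; p C], #|K| == r].
  apply/forall_inP => K; rewrite !inE => /orP[/orP[]|] /eqP->;
  by rewrite pcard // ?(edge_card AH) ?(edge_card BH) ?(edge_card CH).
have pneq (K L : {set V}) : K \subset X -> L \subset X -> K != L -> p K != p L.
  by move=> KX LX; apply: contraNneq => pKL; rewrite -(pK _ KX) pKL pK.
apply: (Hfree U (RGraph unif)).
  exists (p A), (p B), (p C); split=> //=.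
  - rewrite -setUA cardsU1 cards2 !inE negb_or !pneq //.
  - by rewrite -preimsetI pcard // subIset // BX.
  - by rewrite -!preimsetD -preimsetU; apply: preimsetS.
  - by apply/setP => x; have := valP x; rewrite !inE => ->.
by exists val; [exact: val_inj|move=> K; rewrite !inE => /orP[/orP[]|] /eqP->; rewrite pK].
Qed.

Definition covered r (V : finType) (H : rgraph r V) : rel V := fun x y =>
  (x != y) && [exists K in edges H, (x \in K) && (y \in K)].

Lemma covered_sym r (V : finType) (H : rgraph r V) : symmetric (covered H).
Proof.
move=> x y; rewrite /covered eq_sym; congr (_ && _).
by apply: eq_existsb => K; rewrite (andbC (x \in K)).
Qed.

Lemma covered_irr r (V : finType) (H : rgraph r V) : irreflexive (covered H).
Proof. by move=> x; rewrite /covered eqxx. Qed.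

(** If [S] lay in the links of [x] and [y], an edge containing both would contain the symmetric
    difference of [x |: S] and [y |: S]. *)
Lemma Sigma_free_cancellative k (V : finType) (H : rgraph k.+1 V) :
  family_free (Sigma k.+1) H -> cancellative (covered H) k.+1 (edges H).
Proof.
move=> Hfree; split=> [K /edge_card //|K KH|x y S].
  apply/cliqueP => x y xK yK xy; rewrite /covered xy.
  by apply/exists_inP; exists K; rewrite // xK.
case/andP => xy /exists_inP[A AH /andP[xA yA]]; rewrite !inE => /andP[xS SxH].
apply/negP => /andP[yS SyH].
have yx : y \notin x |: S by rewrite !inE negb_or eq_sym xy.
have xy' : x \notin y |: S by rewrite !inE negb_or xy.
have D z w : z \notin w |: S -> (z |: S) :\: (w |: S) = [set z].
  move=> zw; apply/setP => t; rewrite !inE negb_or.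
  have [->|tz] /= := eqVneq t z; first by move: zw; rewrite !inE negb_or andbT.
  by case: (t \in S); rewrite andbF.
apply: (@Sigma_free_edges _ _ _ A _ _ Hfree AH SxH SyH).
- by apply: contraNneq yx => <-.
- by apply: contraNneq xy' => <-.
- by apply: contraNneq yx => ->; rewrite setU11.
- have -> : (x |: S) :&: (y |: S) = S.
    apply/setP => t; rewrite !inE; case: (boolP (t \in S)) => tS; rewrite ?orbT ?orbF //.
    by apply/negbTE; apply: contraNN xy => /andP[/eqP<-].
  by have := edge_card SxH; rewrite cardsU1 xS => -[].
- by rewrite !D // subUset !sub1set xA yA.
Qed.

Lemma min_degree_le r (V : finType) (H : rgraph r V) x : min_degree H <= degree H x.
Proof.
rewrite /min_degree; elim: (index_enum V) (mem_index_enum x) => // y s IH.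
rewrite in_cons big_cons => /orP[/eqP<-|/IH]; first exact: geq_minl.
by apply: leq_trans; apply: geq_minr.
Qed.

(** Numbering [Q] turns the colouring into a map [psi] to the parts. It is injective on every edge,
    whose vertices are pairwise covered. *)
Lemma coloured_blowup k (V : finType) (H : rgraph k.+1 V) Q (c : V -> V) :
  Q \in edges H -> (forall x, c x \in Q) ->
  (forall x y, covered H x y -> c x != c y) ->
  exists (W : finType) (G : rgraph k.+1 W), blowups_of_complete k.+1 k.+1 W G /\ subgraph H G.
Proof.
move=> QH cQ cE; have Qr := edge_card QH.
have [x0 x0Q] : exists x, x \in Q by apply/set0Pn; rewrite -card_gt0 Qr.
pose psi x := cast_ord Qr (enum_rank_in x0Q (c x)).
exists V, (pullback psi (complete_rgraph k.+1 k.+1)); split.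
  by exists psi => K Kr; rewrite pullbackE Kr eqxx.
exists id => // K KH; rewrite imset_id pullbackE (edge_card KH) eqxx inE /=.
rewrite card_in_imset ?(edge_card KH) // => x y xK yK.
move=> /cast_ord_inj/(enum_rank_in_inj (cQ x) (cQ y)) cxy.
apply/eqP/negPn/negP => xy.
have /cE : covered H x y by rewrite /covered xy; apply/exists_inP; exists K; rewrite // xK.
by rewrite cxy eqxx.
Qed.

(** * The Turan density *)

Lemma card_vertex_deleted r (V : finType) (H : rgraph r V) x :
  #|edges (pullback (val : {y : V | y != x} -> V) H)| = #|[set K in edges H | x \notin K]|.
Proof.
rewrite card_pullback; last exact: val_inj.
apply: eq_card => K; rewrite !inE; congr (_ && _).
apply/subsetP/idP => [Kx|xK y yK].
  by apply/negP => /Kx /codomP[[y /= yx] xy]; rewrite xy eqxx in yx.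
have yx : y != x by apply: contraNneq xK => <-.
by apply/codomP; exists (exist _ y yx).
Qed.

Lemma sum_vertex_deleted r (V : finType) (H : rgraph r V) :
  \sum_x #|[set K in edges H | x \notin K]| = #|edges H| * (#|V| - r).
Proof.
rewrite (@sum_card_exchange _ _ _ _ (edges H)) => [|x _]; last first.
  by apply/subsetP => K; rewrite inE => /andP[].
rewrite -sum_nat_const; apply: eq_bigr => K KH.
have -> : #|V| - r = #|~: K| by rewrite -(edge_card KH) -(cardsC K) addKn.
by apply: eq_card => x; rewrite !inE KH.
Qed.

Lemma ffact_le_expn n m : n ^_ m <= n ^ m.
Proof. by elim: m => // m IH; rewrite ffactnSr expnSr leq_mul // leq_subr. Qed.

Definition partite_rgraph r m : rgraph r ('I_r * 'I_m)%type :=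
  pullback fst (complete_rgraph r r).

Lemma partite_blowup r m : blowups_of_complete r r _ (partite_rgraph r m).
Proof. by exists fst => K Kr; rewrite pullbackE Kr eqxx. Qed.

Lemma card_partite_rgraph r m : m ^ r <= #|edges (partite_rgraph r m)|.
Proof.
pose F (f : {ffun 'I_r -> 'I_m}) := [set (i, f i) | i in 'I_r].
have F_inj : injective F.
  move=> f g fg; apply/ffunP => i.
  have : (i, f i) \in F g by rewrite -fg; apply/imsetP; exists i.
  by case/imsetP => j _ [-> ->].
have <- : #|[set F f | f in {ffun 'I_r -> 'I_m}]| = m ^ r.
  by rewrite card_imset // card_ffun !card_ord.
apply/subset_leq_card/subsetP => _ /imsetP[f _ ->].
have Ff : fst @: F f = [set: 'I_r].
  by rewrite -imset_comp; apply/setP => i; rewrite inE; apply/imsetP; exists i.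
rewrite pullbackE Ff inE cardsT card_ord eqxx andbT.
by rewrite card_imset ?card_ord // => i j [].
Qed.

From mathcomp Require Import all_classical all_reals all_analysis.
Require Import Defs.

Import numFieldNormedType.Exports.

Lemma ex_number_ge r (F : rclass r) (V : finType) (H : rgraph r V) :
  family_free F H -> #|edges H| <= ex_number #|V| F.
Proof.
move=> Hfree; pose ev : 'I_#|V| -> V := enum_val; pose G := pullback ev H.
have ev_inj : injective ev := @enum_val_inj _ _.
have Gfree : family_free F G := subgraph_free (pullback_subgraph H ev_inj) Hfree.
have -> : #|edges H| = #|edges G|.
  rewrite card_pullback //; apply: eq_card => K; rewrite inE.
  case: (K \in edges H) => //=; apply/esym/fintype.subsetP => x _.
  by apply/codomP; exists (enum_rank x); rewrite /ev enum_rankK.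
by apply: (@bigop.bigmax_sup _ G) => //; apply/asboolP.
Qed.

Lemma ex_number_le n r (F : rclass r) m :
  (forall H : rgraph r 'I_n, family_free F H -> #|edges H| <= m) -> ex_number n F <= m.
Proof. by move=> h; apply/bigop.bigmax_leqP => H /asboolP; apply: h. Qed.

(** Positivity excludes the case of no F-free r-graph at all, in which the maximum takes its default
    value 0. *)
Lemma ex_number_attained n r (F : rclass r) : 0 < ex_number n F ->
  exists2 H : rgraph r 'I_n, family_free F H & #|edges H| = ex_number n F.
Proof.
move=> ex0; apply: contrapT => h.
suff : ex_number n F <= (ex_number n F).-1 by lia.
apply: ex_number_le => H Hfree.
have := ex_number_ge Hfree; rewrite card_ord.
have : #|edges H| <> ex_number n F by move=> e; apply: h; exists H.
lia.
Qed.

(** Each vertex in turn is deleted from an extremal r-graph on n+1 vertices; every edge survives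
    n+1-r of the deletions. *)
Lemma ex_number_averaging n r (F : rclass r) :
  ex_number n.+1 F * (n.+1 - r) <= n.+1 * ex_number n F.
Proof.
have [->|] := posnP (ex_number n.+1 F); first by rewrite mul0n.
case/ex_number_attained => H Hfree <-.
have := sum_vertex_deleted H; rewrite card_ord => <-.
apply: leq_trans (_ : \sum_(x : 'I_n.+1) ex_number n F <= _); last first.
  by rewrite sum_nat_const card_ord.
apply: leq_sum => x _; rewrite -card_vertex_deleted.
have := ex_number_ge (subgraph_free (pullback_subgraph H val_inj) Hfree :
  family_free F (pullback (val : {y | y != x} -> 'I_n.+1) H)).
by rewrite card_sig cardC1 card_ord.
Qed.

Section Density.
Local Open Scope ring_scope.
Variables (R : realType) (k : nat).
Let r := k.+1.
Let F := Sigma r.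
Let u (n : nat) : R := (ex_number n F)%:R / 'C(n, r)%:R.

Lemma density_decreasing n : (r <= n)%N -> u n.+1 <= u n.
Proof.
move=> rn; rewrite /u ler_pdivrMr ?ltr0n ?bin_gt0 ?(leqW rn) //.
rewrite mulrAC ler_pdivlMr ?ltr0n ?bin_gt0 // -!natrM ler_nat.
rewrite -(@leq_pmul2r (n.+1 - r)) ?subn_gt0 //.
rewrite mulnAC -[leqRHS]mulnA [('C(_, _) * (_ - _))%N]mulnC -mul_bin_down /= mulnA.
by rewrite leq_mul2r [leqRHS]mulnC ex_number_averaging orbT.
Qed.

Lemma density_antitone m n : (r <= m)%N -> (m <= n)%N -> u n <= u m.
Proof.
move=> rm; elim: n => [|n IH]; first by rewrite leqn0 => /eqP->.
rewrite leq_eqVlt => /orP[/eqP->//|]; rewrite ltnS => mn.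
exact: le_trans (density_decreasing (leq_trans rm mn)) (IH mn).
Qed.

Lemma density_ge n : (r <= n)%N -> r`!%:R / r%:R ^+ r <= u n.
Proof.
move=> rn; have n0 : (0 < n)%N by apply: leq_trans rn.
(* On r n vertices the complete r-partite r-graph with equal parts has n^r edges, and r! 'C(rn, r)
   <= (r n)^r. *)
apply: le_trans (density_antitone rn (leq_pmull n (isT : (0 < r)%N))).
have C0 : (0 < 'C(r * n, r))%N by rewrite bin_gt0 leq_pmulr.
rewrite /u ler_pdivlMr ?ltr0n // mulrAC ler_pdivrMr ?exprn_gt0 ?ltr0n //.
rewrite -natrX -!natrM ler_nat mulnC bin_ffact.
apply: leq_trans (ffact_le_expn _ _) _.
rewrite expnMn mulnC leq_mul2r; apply/orP; right.
apply: leq_trans (card_partite_rgraph r n) _.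
have := ex_number_ge (blowup_Sigma_free (partite_blowup r n)).
by rewrite card_prod !card_ord.
Qed.

Lemma turan_density_ge : r`!%:R / r%:R ^+ r <= turan_density R F.
Proof.
(* The value of [limn] is meaningful only under convergence. The density is monotone from index r
   on, hence the shift. *)
have cv : cvgn (fun n => u (n + r)%N).
  apply: nonincreasing_is_cvgn.
    by apply/nonincreasing_seqP => n; apply: density_decreasing; rewrite leq_addl.
  exists 0 => _ [n _ <-]; exact: divr_ge0.
have {}cv : cvgn u.
  by case/cvg_ex : cv => l ul; apply/cvg_ex; exists l; rewrite -(cvg_shiftn r).
apply: limr_ge => //; near=> n; apply: density_ge.
by near: n; exists r.
Unshelve. all: by end_near.
Qed.

End Density.

(** With r = k+1, the density bound divided by (r-1)! is r^(1-r), so the hypothesis on the minimum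
    degree no longer involves the limit. *)
Lemma degree_stable_Sigma (R : realType) k (eps : R) (N0 : nat) :
  (0 < eps)%R ->
  (forall (V : finType) (H : rgraph k.+1 V), N0 <= #|V| ->
     ((k.+1%:R ^- k - eps) * #|V|%:R ^+ k <= (min_degree H)%:R)%R ->
     cancellative (covered H) k.+1 (edges H) ->
     (forall x, min_degree H <= #|link (edges H) x|) ->
     exists Q (c : V -> V), [/\ Q \in edges H, forall x, c x \in Q &
       forall x y, covered H x y -> c x != c y]) ->
  degree_stable R (Sigma k.+1) (blowups_of_complete k.+1 k.+1).
Proof.
move=> eps0 h; split; first by move=> V H; apply: blowup_Sigma_free.
exists eps, N0; split=> // V H VN Hfree Hdeg.
have [|||Q [c [QH cQ cE]]] := h V H VN; last exact: coloured_blowup QH cQ cE.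
- apply: le_trans Hdeg; rewrite ler_wpM2r ?exprn_ge0 // lerD2r.
  rewrite ler_pdivlMr ?ltr0n ?fact_gt0 //; apply: le_trans (turan_density_ge R k).
  rewrite factS natrM exprS invfM mulrACA divff ?pnatr_eq0 // mul1r.
  by rewrite [leRHS]mulrC.
- exact: Sigma_free_cancellative.
- by move=> x; rewrite card_link; apply: min_degree_le.
Qed.

Theorem theorem1p10 (R : realType) (r : nat) (hr : r = 3%N \/ r = 4%N) :
  degree_stable R (Sigma r) (blowups_of_complete r r).
Proof.
case: hr => ->.
  (* This [eps] leaves exactly the coefficient 11/100; [N0] = 1 excludes the empty vertex set. *)
  apply: (@degree_stable_Sigma R 2 (1 / 9 - 11 / 100) 1) => [|V H V0 Hdeg Hc Hlink].
    by lra.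
  apply: (tripartite (@covered_sym _ _ H) (@covered_irr _ _ H) Hc V0 Hlink).
  by move: Hdeg; rewrite -(ler_nat R) natrM natrX natrM; lra.
(* Here the coefficient left is 3/193, and 100 is the threshold of [nbrs_arith]. *)
apply: (@degree_stable_Sigma R 3 (1 / 64 - 3 / 193) 100) => [|V H V0 Hdeg Hc Hlink].
  by lra.
apply: (quadripartite (@covered_sym _ _ H) (@covered_irr _ _ H) Hc V0 Hlink).
by move: Hdeg; rewrite -(ler_nat R) natrM natrX natrM; lra.
Qed.
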